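(* Let $r>0$, $0<R<\infty$, $\varkappa=R/r$, and let $P$ be a random point uniformly distributed over the area of the disk $D_R$. Let $U_\varkappa$ be the perimeter of the ellipse generated by $P$ under the elliptic motion. Then for every $k=1,2,\ldots$ the $k$-th moment of $U_\varkappa$ is $$ \mathbb{E}\big[U_\varkappa^k\big]=\frac{2^{2k+1}r^k}{\varkappa^2}\int_0^{\varkappa} w\,(w+1)^k\left[E\!\left(\frac{2\sqrt{w}}{w+1}\right)\right]^k\mathrm{d}w , $$ and also $$ \mathbb{E}\big[U_\varkappa^k\big]=r^k\left[h(\varkappa)^k-\frac{k}{\varkappa^2}\int_{2\pi}^{h(\varkappa)}x^{k-1}\,\widetilde{w}(x)^2\,\mathrm{d}x\right], $$ where $$h(w)=4(w+1)\,E\!\left(\frac{2\sqrt{w}}{w+1}\right),\qquad w\ge 0,$$ and, for $x\in[2\pi,h(\varkappa)]$, $\widetilde{w}=\widetilde{w}(x)\ge 0$ is the solution of the equation $h(\widetilde{w})=x$.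
   Context: Elliptic motion: a circle of radius $r$ with centre $\varOmega$, attached to a moving plane $\varSigma$ with Cartesian coordinates $(\xi,\eta)$ and origin $\varOmega$, rolls inside a fixed circle of radius $2r$ centred at the origin $O$ of a fixed plane. A point $P=(\xi,\eta)\in\varSigma$ generates in the fixed plane (identified with $\mathbb{C}$) the closed curve $$X(\varphi)=r\,\mathrm{e}^{\mathrm{i}\varphi}+(\xi+\mathrm{i}\eta)\,\mathrm{e}^{-\mathrm{i}\varphi},\qquad 0\le\varphi<2\pi .$$ With $\varrho=\sqrt{\xi^2+\eta^2}$ this is an ellipse with semi-axes $r+\varrho$ and $|r-\varrho|$ (degenerating to a doubly traversed line segment of length $4r$ if $\varrho=r$). ''The ellipse generated by $P$'' means this curve, and its perimeter is the length of the curve over one period $0\le\varphi<2\pi$ (so it is $8r$ in the degenerate case). The disk is $D_R=\{(\xi,\eta)\in\varSigma: 0\le\xi^2+\eta^2\le R^2\}$. The complete elliptic integral of the second kind with modulus $k$ (not parameter $k^2$), $0\le k\le 1$, is $E(k)=\int_0^{\pi/2}\sqrt{1-k^2\sin^2\theta}\;\mathrm{d}\theta$. *)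

(* Defs.v *)
From HB Require Import structures.
From mathcomp Require Import all_boot all_order all_algebra.
From mathcomp Require Import all_classical all_reals all_analysis.
From mathcomp Require Import complex.

Set Implicit Arguments.
Unset Strict Implicit.
Unset Printing Implicit Defensive.

Import Order.TTheory GRing.Theory Num.Theory.
Import numFieldNormedType.Exports.

Local Open Scope classical_set_scope.
Local Open Scope ring_scope.
Local Open Scope complex_scope.

Section EllipticMotion.
Variable R : realType.
Implicit Types (r t k w : R) (p : R * R).

Definition cis t : R[i] := cos t +i* sin t.

(* The point p = (xi, eta) of the moving plane generates this closed curve in
   the fixed plane; r is the radius of the rolling circle. *)
Definition elliptic_curve r p t : R[i] :=
  r%:C * cis t + (p.1 +i* p.2) * cis (- t).

(* Length of a continuously differentiable plane curve X over [a, b]: the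
   integral of |X'|, with X' computed coordinatewise. *)
Definition curve_length (X : R -> R[i]) (a b : R) : R :=
  \int[lebesgue_measure]_(t in `[a, b])
    Num.sqrt (derive1 (fun s => complex.Re (X s)) t ^+ 2
              + derive1 (fun s => complex.Im (X s)) t ^+ 2).

(* One full period, so a degenerate ellipse (a segment) is counted twice. *)
Definition perimeter r p : R := curve_length (elliptic_curve r p) 0 (2 * pi).

(* Complete elliptic integral of the second kind; k is the modulus. *)
Definition ellipticE k : R :=
  \int[lebesgue_measure]_(t in `[0, pi / 2])
    Num.sqrt (1 - k ^+ 2 * sin t ^+ 2).

Definition h w : R :=
  4 * (w + 1) * ellipticE (2 * Num.sqrt w / (w + 1)).

Definition plane := (measurableTypeR R * measurableTypeR R)%type.

Definition area (A : set plane) : \bar R :=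
  (@lebesgue_measure R \x @lebesgue_measure R)%E A.

Definition disk (rho : R) : set plane :=
  [set p | p.1 ^+ 2 + p.2 ^+ 2 <= rho ^+ 2].

(* Meaningful for regions D of positive finite area. *)
Definition uniform_over (D : set plane) (Q : set plane -> \bar R) : Prop :=
  forall A : set plane, measurable A ->
    Q A = (fine (area (A `&` D)) / fine (area D))%:E.

End EllipticMotion.

(* Main.v *)
Require Import Defs.
From HB Require Import structures.
From mathcomp Require Import all_boot all_order all_algebra.
From mathcomp Require Import all_classical all_reals all_analysis.
From mathcomp Require Import measurable_realfun ring lra.

Set Implicit Arguments.
Unset Strict Implicit.
Unset Printing Implicit Defensive.

Import Order.TTheory GRing.Theory Num.Theory.
Import numFieldNormedType.Exports.

Local Open Scope classical_set_scope.
Local Open Scope ring_scope.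

(** The speed of the generated curve satisfies
    |X'(t)|^2 = (r + m)^2 - 4 r m sin^2 (t + c), where m is the distance of P to
    the centre and the phase c depends on the polar angle of P only.  By
    periodicity and symmetry the perimeter is therefore
    4 * quarter_length r m, which by homogeneity is r h(m / r)
    ([perimeterE], [quarter_lengthZ], [hE]).  So U is r h(T), where T = m / r
    has P(T <= s) = s^2 / kappa^2 on [0, kappa], because the area of a disk is
    proportional to the square of its radius ([uniform_disk_prob]).

    On [0, +oo[ the function h is continuous, being Lipschitz
    ([quarter_length_lipschitz]), and strictly increasing
    ([quarter_length_lt]).  Together with h 0 = 2 pi this gives the unique
    solution of h w = x for 2 pi <= x <= h kappa.

    The expectation is evaluated by comparing increments.  For a nondecreasing
    F, the contribution to E[F(T)] of the
    event s < T <= t and the integral of 2 w F(w) / kappa^2 over [s, t] both lie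
    between F(s) and F(t) times (t^2 - s^2) / kappa^2, hence differ by at most
    C (t - s) (F(t) - F(s)).  Two functions whose increments are that close have
    the same total increment ([increments_eq]): the errors over n equal steps
    add up to O(1/n), since the increments of F telescope.  This proves the
    first formula ([integral_square_law]).  The second one follows from the
    first by integration by parts for the inverse function of h, which is
    proved by the same comparison of increments ([Rintegral_inverse]). *)

(** * Integrals of continuous functions over segments *)

Section ContinuousIntegrals.
Variable R : realType.
Notation mu := (@lebesgue_measure R).
Implicit Types (f : R -> R) (a b c d : R).

Lemma continuous_integrable_itv f a b :
  continuous f -> mu.-integrable `[a, b] (EFin \o f).
Proof.
move=> cf; apply: continuous_compact_integrable; first exact: segment_compact.
exact: continuous_subspaceT.
Qed.

Lemma Rintegral_itv_split f a b c : a <= b -> b <= c ->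
  mu.-integrable `[a, c] (EFin \o f) ->
  \int[mu]_(x in `[a, c]) f x =
  \int[mu]_(x in `[a, b]) f x + \int[mu]_(x in `[b, c]) f x.
Proof.
move=> ab bc fi; rewrite -[X in _ + X]Rintegral_itv_obnd_cbnd; last first.
  by apply: integrableS fi => //; apply: subset_itvr; rewrite bnd_simp.
by rewrite -(Rintegral_itvB fi) ?bnd_simp// addrC subrK.
Qed.

Lemma Rintegral_affine f a b c d : continuous f -> 0 < c -> a <= b ->
  \int[mu]_(x in `[c * a + d, c * b + d]) f x =
  c * \int[mu]_(x in `[a, b]) f (c * x + d).
Proof.
move=> cf c0 ab; pose F x := c * x + d.
have dF (x : R) : is_derive x (1 : R) F c.
  have -> : c = c *: (1 : R) + 0 by rewrite addr0 [_ *: _]mulr1.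
  by apply: is_deriveD.
have F' : derive1 F = cst c by apply/funext => x; rewrite derive1E; apply: derive_val.
have cF : continuous F.
  by move=> x; apply: continuousD; [exact: mulrl_continuous|exact: cst_continuous].
have := @integration_by_substitution_increasing R F f a b ab.
rewrite F' => /(_ _ _ _ _ _ _) sub.
rewrite -RintegralZl//; last first.
  by apply: continuous_integrable_itv => x; exact: (continuous_comp (cF x) (cf _)).
congr fine; rewrite sub.
- by apply: eq_integral => x _ /=; rewrite mulrC.
- by move=> x y _ _ xy; rewrite /F ltrD2r ltr_pM2l.
- by move=> x _; exact: cst_continuous.
- exact: is_cvg_cst.
- exact: is_cvg_cst.
- split.
  + by move=> x _; case: (dF x).
  + by apply: cvg_at_right_filter; exact: cF.
  + by apply: cvg_at_left_filter; exact: cF.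
- exact: continuous_subspaceT.
Qed.

Lemma Rintegral_reflect f a b : continuous f -> a <= b ->
  \int[mu]_(x in `[a, b]) f (a + b - x) = \int[mu]_(x in `[a, b]) f x.
Proof.
move=> cf ab; pose F x := a + b - x.
have dF (x : R) : is_derive x (1 : R) F (- 1).
  by rewrite -[- 1]add0r; apply: is_deriveB.
have F' : derive1 F = cst (- 1).
  by apply/funext => x; rewrite derive1E; apply: derive_val.
have cF : continuous F.
  by move=> x; apply: cvgB; [exact: cvg_cst|exact: cvg_id].
have Fa : F a = b by rewrite /F; ring.
have Fb : F b = a by rewrite /F; ring.
have := @integration_by_substitution_decreasing R F f a b ab.
rewrite F' Fa Fb => /(_ _ _ _ _ _ _) sub.
congr fine; rewrite sub.
- by apply: eq_integral => x _ /=; rewrite opprK mulr1.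
- by move=> x y _ _ xy; rewrite /F ltrD2l ltrN2.
- by move=> x _; exact: cst_continuous.
- exact: is_cvg_cst.
- exact: is_cvg_cst.
- split.
  + by move=> x _; case: (dF x).
  + by apply: cvg_at_right_filter; exact: cF.
  + by apply: cvg_at_left_filter; exact: cF.
- exact: continuous_subspaceT.
Qed.

(** The translated window [c, T + c] loses [0, c] and gains [T, T + c], over
    which f has the same integral. *)
Lemma Rintegral_periodic f T c : continuous f ->
  (forall x, f (x + T) = f x) -> 0 <= c -> c <= T ->
  \int[mu]_(x in `[0, T]) f (x + c) = \int[mu]_(x in `[0, T]) f x.
Proof.
move=> cf fT c0 cT; have T0 := le_trans c0 cT.
have := Rintegral_affine c cf ltr01 T0.
under [in X in _ = X -> _]eq_Rintegral do rewrite mul1r.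
rewrite !mul1r add0r => <-.
have Tc : T <= T + c by rewrite lerDl.
rewrite (Rintegral_itv_split cT Tc); last exact: continuous_integrable_itv.
rewrite (Rintegral_itv_split c0 cT); last exact: continuous_integrable_itv.
have := Rintegral_affine T cf ltr01 c0.
under [in X in _ = X -> _]eq_Rintegral do rewrite mul1r fT.
by rewrite !mul1r add0r [c + T]addrC => ->; rewrite addrC.
Qed.

(** By the mean value theorem, applied to the antiderivative of f, the integral
    is f(c) (b - a) for some c strictly inside the interval. *)
Lemma Rintegral_gt0 f a b : continuous f -> a < b ->
  (forall x, a < x < b -> 0 < f x) -> 0 < \int[mu]_(x in `[a, b]) f x.
Proof.
move=> cf ab f0; pose F x := \int[mu]_(t in `[a, x]) f t.
have [x||c] := @MVT R F f a b ab.
- rewrite in_itv /= => /andP[ax xb].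
  have [dF F'] := @continuous_FTC1_closed R f a x b xb
    (continuous_integrable_itv a b cf) ax (cf x).
  by rewrite -F' derive1E; apply: derivableP.
- by apply: parameterized_integral_continuous; [exact: ltW|exact: continuous_integrable_itv].
- rewrite in_itv /= => /f0 fc Fc.
  have Fa : F a = 0 by rewrite /F set_itv1 Rintegral_set1.
  by rewrite -[ltRHS]subr0 -{2}Fa Fc mulr_gt0 // subr_gt0.
Qed.

End ContinuousIntegrals.

(** * The perimeter as a function of the distance to the centre *)

Section Perimeter.
Variable R : realType.
Notation mu := (@lebesgue_measure R).
Implicit Types (r w t q : R) (p : R * R).

(** The squared modulus of a + b e^(iu), where q = sin^2 (u / 2); a stands for
    the radius r and b for the distance of the generating point to the
    centre. *)
Definition sq_speed a b q : R := (a + b) ^+ 2 - 4 * a * b * q.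

Lemma sq_speed_ge0 a b q : 0 <= q <= 1 -> 0 <= sq_speed a b q.
Proof.
move=> /andP[q0 q1].
have -> : sq_speed a b q = (b + a * (1 - 2 * q)) ^+ 2 + a ^+ 2 * (4 * q * (1 - q)).
  by rewrite /sq_speed; ring.
by rewrite addr_ge0 ?sqr_ge0 // mulr_ge0 ?sqr_ge0 // mulr_ge0 ?subr_ge0 // mulr_ge0.
Qed.

Lemma sin2_itv t : 0 <= sin t ^+ 2 <= 1.
Proof. by rewrite sqr_ge0 /= sin2cos2 gerBl sqr_ge0. Qed.

Definition speed a b t : R := Num.sqrt (sq_speed a b (sin t ^+ 2)).

(** A quarter of the perimeter of the ellipse with semi-axes a + b and
    |a - b|.  On [0, +oo[ it gives h = 4 * quarter_length 1, with an integrand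
    that is visibly Lipschitz in b. *)
Definition quarter_length a b : R := \int[mu]_(t in `[0, pi / 2]) speed a b t.

Lemma continuous_sin2 : continuous (fun t : R => sin t ^+ 2).
Proof.
by move=> t; rewrite /continuous_at; apply: cvgM; exact: continuous_sin.
Qed.

Lemma continuous_speed a b : continuous (speed a b).
Proof.
move=> t; apply: (@continuous_comp _ _ _ (fun t => sq_speed a b (sin t ^+ 2)) Num.sqrt).
  apply: cvgB; first exact: cvg_cst.
  by apply: cvgM; [exact: cvg_cst|exact: continuous_sin2].
exact: sqrt_continuous.
Qed.

Lemma elliptic_curveE r p : (fun s => complex.Re (elliptic_curve r p s)) =
    (fun s => (r + p.1) * cos s + p.2 * sin s) /\
  (fun s => complex.Im (elliptic_curve r p s)) =
    (fun s => (r - p.1) * sin s + p.2 * cos s).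
Proof.
by split; apply/funext => s; rewrite /elliptic_curve /cis cosN sinN /=; ring.
Qed.

Lemma derive1_cos_sin (a b t : R) :
  derive1 (fun s => a * cos s + b * sin s) t = b * cos t - a * sin t.
Proof.
rewrite derive1E.
have d : is_derive t (1 : R) (fun s : R => a * cos s + b * sin s)
    (a *: (- sin t) + b *: cos t).
  by apply: is_deriveD.
by rewrite (@derive_val _ _ _ _ _ _ _ d) /GRing.scale /=; ring.
Qed.

(** The polar angle is written pi - 2 c because the squared speed is then
    r^2 + m^2 + 2 r m cos (2 t + 2 c), in which cos (2 t + 2 c) is
    1 - 2 sin^2 (t + c); the range 0 <= c <= pi keeps the shift within a
    period. *)
Lemma polar (x y : R) : exists2 c, 0 <= c <= pi &
  x = - Num.sqrt (x ^+ 2 + y ^+ 2) * cos (2 * c) /\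
  y = Num.sqrt (x ^+ 2 + y ^+ 2) * sin (2 * c).
Proof.
set m := Num.sqrt _.
have m2 : m ^+ 2 = x ^+ 2 + y ^+ 2 by rewrite sqr_sqrtr // addr_ge0 ?sqr_ge0.
have mge0 : 0 <= m by exact: sqrtr_ge0.
clearbody m.
have [m0|m0] := eqVneq m 0.
  exists 0; first by rewrite lexx pi_ge0.
  rewrite m0 oppr0 !mul0r; move/eqP: m2; rewrite m0 expr0n eq_sym.
  rewrite paddr_eq0 ?sqr_ge0 // !sqrf_eq0 => /andP[/eqP -> /eqP ->].
  by split.
have m_gt0 : 0 < m by rewrite lt_def m0 mge0.
have xm : `|- x / m| <= 1.
  rewrite normrM normrN normfV (gtr0_norm m_gt0) ler_pdivrMr // mul1r.
  rewrite -ler_sqr ?nnegrE ?normr_ge0 ?(ltW m_gt0) // real_normK ?num_real // m2.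
  by rewrite lerDl sqr_ge0.
have xm1 : - 1 <= - x / m <= 1 by rewrite -ler_norml.
pose A := acos (- x / m).
have cA : cos A = - x / m by apply: acosK; rewrite in_itv.
have A0 : 0 <= A <= pi by rewrite acos_ge0 ?acos_lepi.
have sA : m * sin A = `|y|.
  have sA0 : 0 <= m * sin A by rewrite mulr_ge0 ?sin_ge0_pi.
  rewrite -[LHS]ger0_norm // -2!sqrtr_sqr exprMn sin2cos2 cA; congr Num.sqrt.
  have -> : m ^+ 2 * (1 - (- x / m) ^+ 2) = m ^+ 2 - x ^+ 2 by field.
  by rewrite m2 addrAC subrr add0r.
have xA : x = - m * cos A by rewrite cA; field.
have [y0|y0] := leP 0 y.
  exists (A / 2); first lra.
  have -> : 2 * (A / 2) = A by field.
  by rewrite sA ger0_norm.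
exists (pi - A / 2); first lra.
have -> : 2 * (pi - A / 2) = - A + pi *+ 2 by rewrite mulr2n; field.
by rewrite cosD2pi sinD2pi cosN sinN mulrN sA ltr0_norm // opprK.
Qed.

(** The phase c is removed by periodicity; the integral over a full turn then
    consists of four equal quarters, because sin^2 has period pi and is
    symmetric about pi / 2. *)
Lemma perimeterE r p : 0 <= r ->
  perimeter r p = 4 * quarter_length r (Num.sqrt (p.1 ^+ 2 + p.2 ^+ 2)).
Proof.
move=> r0; rewrite /perimeter /curve_length.
have [-> ->] := elliptic_curveE r p.
have [c c0pi [p1 p2]] := polar p.1 p.2.
set m := Num.sqrt _ in p1 p2 *.
have -> : \int[mu]_(t in `[0, 2 * pi])
    Num.sqrt (derive1 (fun s => (r + p.1) * cos s + p.2 * sin s) t ^+ 2 +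
      derive1 (fun s => (r - p.1) * sin s + p.2 * cos s) t ^+ 2) =
    \int[mu]_(t in `[0, 2 * pi]) speed r m (t + c).
  apply: eq_Rintegral => t _; rewrite derive1_cos_sin.
  have -> : (fun s => (r - p.1) * sin s + p.2 * cos s) =
            (fun s => p.2 * cos s + (r - p.1) * sin s).
    by apply/funext => s; rewrite addrC.
  rewrite derive1_cos_sin /speed /sq_speed; congr Num.sqrt.
  have ct := cos2Dsin2 t; have cc := cos2Dsin2 c.
  have e1 : p.1 = m * (sin c ^+ 2 - cos c ^+ 2).
    by rewrite p1 mulr_natl cos_mulr2n -cc mulr2n; ring.
  have e2 : p.2 = 2 * m * (cos c * sin c).
    by rewrite p2 mulr_natl sin_mulr2n mulr2n; ring.
  have -> : (r + m) ^+ 2 = r ^+ 2 * (cos t ^+ 2 + sin t ^+ 2) +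
      m ^+ 2 * (cos t ^+ 2 + sin t ^+ 2) * (cos c ^+ 2 + sin c ^+ 2) ^+ 2 +
      2 * r * m * (cos t ^+ 2 + sin t ^+ 2) * (cos c ^+ 2 + sin c ^+ 2).
    by rewrite ct cc; ring.
  by rewrite e1 e2 sinD; ring.
have cs := @continuous_speed r m.
have spi t : speed r m (t + pi) = speed r m t.
  by rewrite /speed sinDpi sqrrN.
have s2pi t : speed r m (t + 2 * pi) = speed r m t.
  by rewrite mulr_natl mulr2n addrA !spi.
rewrite (Rintegral_periodic cs s2pi); try (have := @pi_ge0 R; lra).
have pi2 : 0 <= pi / 2 :> R by rewrite divr_ge0 ?pi_ge0.
have pi0 : 0 <= pi :> R := pi_ge0 R.
have half : \int[mu]_(t in `[0, pi]) speed r m t = 2 * quarter_length r m.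
  rewrite (Rintegral_itv_split pi2 _ (continuous_integrable_itv _ _ cs)); last lra.
  have := Rintegral_affine (pi / 2) cs ltr01 pi2.
  rewrite !mul1r add0r -splitr => ->.
  rewrite (_ : 2 * quarter_length r m = quarter_length r m + quarter_length r m); last by ring.
  congr (_ + _); rewrite /quarter_length.
  rewrite -(Rintegral_reflect cs pi2).
  apply: eq_Rintegral => t _; rewrite /speed add0r mul1r.
  by rewrite -[pi / 2 - t]opprB sinN sqrrN sinBpihalf sqrrN sinDpihalf.
rewrite (Rintegral_itv_split pi0 _ (continuous_integrable_itv _ _ cs)); last lra.
have := Rintegral_affine pi cs ltr01 pi0.
under [X in _ = _ * X -> _]eq_Rintegral do rewrite mul1r spi.
rewrite mulr0 add0r mul1r -mulr2n mulr_natl => ->.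
by rewrite mul1r half; ring.
Qed.

End Perimeter.

(** * The length function h *)

Section LengthFunction.
Variable R : realType.
Notation mu := (@lebesgue_measure R).
Implicit Types (a b c t u v w n q : R).

Lemma quarter_lengthZ c a b : 0 <= c ->
  quarter_length (c * a) (c * b) = c * quarter_length a b.
Proof.
move=> c0; rewrite /quarter_length -RintegralZl //; last first.
  exact: continuous_integrable_itv (@continuous_speed R a b).
apply: eq_Rintegral => t _; rewrite /speed.
have -> : sq_speed (c * a) (c * b) (sin t ^+ 2) = c ^+ 2 * sq_speed a b (sin t ^+ 2).
  by rewrite /sq_speed; ring.
by rewrite sqrtrM ?sqr_ge0 // sqrtr_sqr ger0_norm.
Qed.

(** The factor w + 1 is moved under the square root:
    (w + 1)^2 (1 - k^2 q) = (w + 1)^2 - 4 w q for k = 2 sqrt w / (w + 1). *)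
Lemma hE w : 0 <= w -> h w = 4 * quarter_length 1 w.
Proof.
move=> w0; rewrite /h -mulrA; congr (_ * _).
have w1 : 0 < w + 1 by lra.
have {1}-> : w + 1 = 1 * (w + 1) by rewrite mul1r.
rewrite -mulrA mul1r -[in LHS](RintegralZl) //; last first.
  apply: continuous_integrable_itv => t.
  apply: (@continuous_comp _ _ _
    (fun t => 1 - (2 * Num.sqrt w / (w + 1)) ^+ 2 * sin t ^+ 2) Num.sqrt).
    apply: cvgB; first exact: cvg_cst.
    by apply: cvgM; [exact: cvg_cst|exact: continuous_sin2].
  exact: sqrt_continuous.
apply: eq_Rintegral => t _; rewrite /speed.
rewrite -{1}(ger0_norm (ltW w1)) -sqrtr_sqr -sqrtrM ?sqr_ge0 //.
congr Num.sqrt; rewrite /sq_speed !exprMn exprVn sqr_sqrtr //.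
by field; rewrite gt_eqF.
Qed.

(** This is the triangle inequality for the plane vectors (u, sqrt n) and
    (v, sqrt n). *)
Lemma sqrt_lipschitz n u v : 0 <= n ->
  `|Num.sqrt (u ^+ 2 + n) - Num.sqrt (v ^+ 2 + n)| <= `|u - v|.
Proof.
move=> n0.
have key x y : Num.sqrt (x ^+ 2 + n) <= `|x - y| + Num.sqrt (y ^+ 2 + n).
  have s0 := sqrtr_ge0 (y ^+ 2 + n).
  rewrite -ler_sqr ?nnegrE ?sqrtr_ge0 ?addr_ge0 // sqrrD !sqr_sqrtr ?addr_ge0 ?sqr_ge0 //.
  rewrite real_normK ?num_real //.
  have ys : `|y| <= Num.sqrt (y ^+ 2 + n).
    by rewrite -sqrtr_sqr ler_sqrt ?addr_ge0 ?sqr_ge0 // lerDl.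
  have : y * (x - y) <= `|x - y| * Num.sqrt (y ^+ 2 + n).
    apply: le_trans (ler_norm _) _; rewrite normrM mulrC.
    by apply: ler_wpM2l.
  by rewrite mulr2n; nra.
have k1 := key u v; have k2 := key v u; rewrite distrC in k2.
by rewrite ler_norml; apply/andP; split; lra.
Qed.

(** The modulus of a + b e^(iu) is 1-Lipschitz in b. *)
Lemma speed_lipschitz a b b' t : `|speed a b t - speed a b' t| <= `|b - b'|.
Proof.
have [q0 q1] := andP (sin2_itv t); rewrite /speed; set q := sin t ^+ 2 in q0 q1 *.
pose n := a ^+ 2 * (4 * q * (1 - q)).
have sq_speedE x : sq_speed a x q = (x + a * (1 - 2 * q)) ^+ 2 + n.
  by rewrite /sq_speed /n; ring.
have n0 : 0 <= n by rewrite mulr_ge0 ?sqr_ge0 // mulr_ge0 ?subr_ge0 // mulr_ge0.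
rewrite !sq_speedE; apply: le_trans (sqrt_lipschitz _ _ n0) _.
by rewrite opprD addrACA subrr addr0.
Qed.

Lemma quarter_length_lipschitz a b b' :
  `|quarter_length a b - quarter_length a b'| <= `|b - b'| * (pi / 2).
Proof.
have pi2 : 0 <= pi / 2 :> R by rewrite divr_ge0 ?pi_ge0.
have i x := continuous_integrable_itv 0 (pi / 2) (@continuous_speed R a x).
rewrite /quarter_length -RintegralB //.
apply: le_trans (le_normr_Rintegral _ _) _ => //.
  have := @continuous_integrable_itv R (fun t => speed a b t - speed a b' t) 0 (pi / 2).
  by apply => t; apply: cvgB; exact: continuous_speed.
have -> : `|b - b'| * (pi / 2) = \int[mu]_(t in `[0, pi / 2]) `|b - b'|.
  by rewrite Rintegral_cst //= lebesgue_measure_itv /= lte_fin;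
    case: ltgtP pi2 => //= [_|<-] _; rewrite ?subr0.
apply: le_Rintegral => //.
- apply: (continuous_integrable_itv (f := fun t => `|speed a b t - speed a b' t|)).
  move=> t; apply: cvg_norm; apply: cvgB; exact: continuous_speed.
- by apply: (continuous_integrable_itv (f := cst _)) => t; exact: cvg_cst.
- by move=> t _; exact: speed_lipschitz.
Qed.

Lemma continuous_quarter_length a : continuous (quarter_length a).
Proof.
move=> b; apply/cvgrPdist_le => e e0.
have p0 : 0 < (pi / 2 : R) by rewrite divr_gt0 ?pi_gt0.
near=> b'; apply: le_trans (quarter_length_lipschitz _ _ _) _.
rewrite -ler_pdivlMr //; near: b'.
by exists (e / (pi / 2)) => /=; [exact: divr_gt0|move=> z /ltW].
Unshelve. all: by end_near. Qed.

(** A single speed need not increase with w (for q near 1 it decreases when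
    w < 1), but the sum of the speeds at two complementary points does.  Its
    square is 2 (A + sqrt ((A - m)^2 + m (2 - m))) with A = 1 + w^2 and
    m = 2 (1 - 2 q)^2 in [0, 2[, and the square root has slope greater than -1
    in A. *)
Lemma speed_pair_lt w1 w2 q : 0 <= w1 -> w1 < w2 -> 0 < q < 1 ->
  Num.sqrt (sq_speed 1 w1 q) + Num.sqrt (sq_speed 1 w1 (1 - q)) <
  Num.sqrt (sq_speed 1 w2 q) + Num.sqrt (sq_speed 1 w2 (1 - q)).
Proof.
move=> w10 w12 /andP[q0 q1].
have rg w x : 0 < x < 1 -> 0 <= sq_speed 1 w x.
  by move=> /andP[x0 x1]; apply: sq_speed_ge0; rewrite !ltW.
have q01 : 0 < q < 1 by rewrite q0.
have q01' : 0 < 1 - q < 1 by lra.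
have sq w : (Num.sqrt (sq_speed 1 w q) + Num.sqrt (sq_speed 1 w (1 - q))) ^+ 2 =
    2 * (1 + w ^+ 2 + Num.sqrt (sq_speed 1 w q * sq_speed 1 w (1 - q))).
  rewrite sqrrD !sqr_sqrtr ?rg // -sqrtrM ?rg // mulr2n.
  by rewrite /sq_speed; ring.
rewrite -ltr_sqr ?nnegrE ?addr_ge0 ?sqrtr_ge0 // !sq ltr_pM2l //.
set y1 := Num.sqrt (sq_speed 1 w1 q * _); set y2 := Num.sqrt (sq_speed 1 w2 q * _).
pose m := 2 * (1 - 2 * q) ^+ 2.
have prodE w : sq_speed 1 w q * sq_speed 1 w (1 - q) =
  (1 + w ^+ 2 - m) ^+ 2 + m * (2 - m) by rewrite /sq_speed /m; ring.
have m0 : 0 <= m by rewrite mulr_ge0 ?sqr_ge0.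
have m2 : m < 2 by rewrite /m; nra.
have y2E : y2 ^+ 2 = (1 + w2 ^+ 2 - m) ^+ 2 + m * (2 - m).
  by rewrite sqr_sqrtr ?prodE // -prodE mulr_ge0 ?rg.
have y1E : y1 ^+ 2 = (1 + w1 ^+ 2 - m) ^+ 2 + m * (2 - m).
  by rewrite sqr_sqrtr ?prodE // -prodE mulr_ge0 ?rg.
have y10 : 0 <= y1 := sqrtr_ge0 _.
have y20 : 0 <= y2 := sqrtr_ge0 _.
have d0 : w1 ^+ 2 < w2 ^+ 2 by rewrite ltr_sqr ?nnegrE //; lra.
have s20 : 0 <= w2 ^+ 2 by exact: sqr_ge0.
move: y1E y2E d0 s20; move: (w1 ^+ 2) (w2 ^+ 2) => s1 s2 y1E y2E d0 s20.
suff : y1 < y2 + (s2 - s1) by lra.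
(* Squaring y1 < y2 + (s2 - s1) and dividing by 2 (s2 - s1) leaves this. *)
have key : m - 1 - s2 < y2.
  case: (ltP (m - 1 - s2) 0) => [|g0]; first lra.
  have mm : 0 < m * (2 - m) by rewrite mulr_gt0 //; lra.
  by rewrite -ltr_sqr ?nnegrE // y2E -[ltLHS]sqrrN !opprB; lra.
rewrite -ltr_sqr ?nnegrE //; last lra.
rewrite sqrrD y1E y2E mulr2n -subr_gt0.
have : 0 < 2 * (s2 - s1) * (y2 - (m - 1 - s2)) by rewrite !mulr_gt0 ?subr_gt0.
by congr (_ < _); ring.
Qed.

(** Averaging over t and pi / 2 - t, which exchanges sin^2 and cos^2, produces
    the sum of speeds of [speed_pair_lt]. *)
Lemma quarter_length_sym w : quarter_length 1 w =
  2^-1 * \int[mu]_(t in `[0, pi / 2]) (speed 1 w t + speed 1 w (pi / 2 - t)).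
Proof.
have cs := @continuous_speed R 1 w.
have pi2 : 0 <= pi / 2 :> R by rewrite divr_ge0 ?pi_ge0.
have cs' : continuous (fun t => speed 1 w (pi / 2 - t)).
  move=> t; apply: (@continuous_comp _ _ _ (fun t => pi / 2 - t)); last exact: cs.
  by apply: cvgB; [exact: cvg_cst|exact: cvg_id].
rewrite RintegralD //; [|exact: continuous_integrable_itv..].
have := Rintegral_reflect cs pi2; rewrite add0r => ->.
by rewrite -/(quarter_length 1 w); field.
Qed.

Lemma quarter_length_lt w1 w2 : 0 <= w1 -> w1 < w2 ->
  quarter_length 1 w1 < quarter_length 1 w2.
Proof.
move=> w10 w12; rewrite !quarter_length_sym ltr_pM2l ?invr_gt0 // -subr_gt0.
pose S w t := speed 1 w t + speed 1 w (pi / 2 - t).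
have cS w : continuous (S w).
  move=> t; apply: cvgD; first exact: continuous_speed.
  apply: (@continuous_comp _ _ _ (fun t => pi / 2 - t)); last exact: continuous_speed.
  by apply: cvgB; [exact: cvg_cst|exact: cvg_id].
have iS w := continuous_integrable_itv 0 (pi / 2) (cS w).
rewrite -RintegralB //; [|exact: iS..].
apply: (@Rintegral_gt0 R (fun t => S w2 t - S w1 t) 0 (pi / 2)).
- by move=> t; apply: cvgB; exact: cS.
- by rewrite divr_gt0 ?pi_gt0.
- move=> t /andP[t0 t1]; rewrite subr_gt0 /S /speed.
  have -> : sin (pi / 2 - t) ^+ 2 = 1 - sin t ^+ 2.
    by rewrite -opprB sinN sqrrN sinBpihalf sqrrN cos2sin2.
  apply: speed_pair_lt => //.
  have s0 : 0 < sin t by apply: sin_gt0_pihalf; rewrite t0.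
  have c0 : 0 < cos t by apply: cos_gt0_pihalf; lra.
  by rewrite exprn_gt0 //= sin2cos2 ltrBlDr ltrDl exprn_gt0.
Qed.

End LengthFunction.

(** * The area of a disk *)

Section DiskArea.
Variable R : realType.
Notation mu := (@lebesgue_measure R).
Implicit Types (s x y : R).

Lemma measurable_sqnorm :
  measurable_fun setT (fun p : plane R => p.1 ^+ 2 + p.2 ^+ 2).
Proof.
by apply: measurable_funD; apply: measurable_funX;
  [exact: measurable_fst|exact: measurable_snd].
Qed.

Lemma measurable_disk s : measurable (disk s).
Proof.
rewrite (_ : disk s = [set: plane R] `&`
    (fun p : plane R => p.1 ^+ 2 + p.2 ^+ 2) @^-1` `]-oo, s ^+ 2]); last first.
  by apply/seteqP; split => p /=; rewrite /disk /= in_itv //= => -[].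
exact: measurable_sqnorm.
Qed.

(** Outside of the disk the square root of a negative number is 0, so that the
    formula covers empty sections too. *)
Lemma xsection_disk s x : mu (xsection (disk s) x) =
  (2 * Num.sqrt (s ^+ 2 - x ^+ 2))%:E.
Proof.
have [xs|xs] := leP (x ^+ 2) (s ^+ 2).
  have -> : xsection (disk s) x =
      `[- Num.sqrt (s ^+ 2 - x ^+ 2), Num.sqrt (s ^+ 2 - x ^+ 2)]%classic.
    apply/seteqP; split => y; rewrite /xsection /= in_itv /= inE /disk /=.
      move=> h; rewrite -ler_norml -sqrtr_sqr ler_sqrt ?sqr_ge0 ?subr_ge0 //; lra.
    rewrite -ler_norml -sqrtr_sqr ler_sqrt ?sqr_ge0 ?subr_ge0 //; lra.
  rewrite lebesgue_measure_itv /= lte_fin.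
  set a := Num.sqrt _; have := sqrtr_ge0 (s ^+ 2 - x ^+ 2); rewrite -/a => a0.
  case: ifPn => [_|]; first by rewrite -EFinD; congr EFin; ring.
  by rewrite -leNgt => h; congr EFin; lra.
rewrite ler0_sqrtr ?subr_le0 ?ltW // mulr0 (_ : xsection _ _ = set0) ?measure0 //.
rewrite -subset0 => y; rewrite /xsection /= inE /disk /= => h.
by have := sqr_ge0 y; lra.
Qed.

(** Its value pi cancels in the ratios of areas that define the uniform law. *)
Definition unit_area : R := \int[mu]_(x in `[- 1, 1]) (2 * Num.sqrt (1 - x ^+ 2)).

Lemma continuous_halfchord s : continuous (fun x : R => 2 * Num.sqrt (s ^+ 2 - x ^+ 2)).
Proof.
move=> x; apply: cvgM; first exact: cvg_cst.
apply: (@continuous_comp _ _ _ (fun x => s ^+ 2 - x ^+ 2) Num.sqrt).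
  by apply: cvgB; [exact: cvg_cst|exact: exprn_continuous].
exact: sqrt_continuous.
Qed.

Lemma unit_area_gt0 : 0 < unit_area.
Proof.
have := @continuous_halfchord 1; rewrite expr1n => c1.
apply: Rintegral_gt0 => //.
by move=> x /andP[x0 x1]; rewrite mulr_gt0 // sqrtr_gt0; nra.
Qed.

(** The substitution x = s u carries the half-chord of the disk of radius s to
    s times that of the unit disk. *)
Lemma area_disk s : 0 <= s -> area (disk s) = (s ^+ 2 * unit_area)%:E.
Proof.
rewrite /area /product_measure1 => s_ge0.
under eq_integral do rewrite /= xsection_disk.
move: s_ge0; rewrite le_eqVlt => /predU1P[<-|s0].
  rewrite expr0n mul0r integral0_eq // => x _.
  by rewrite ler0_sqrtr ?mulr0 // sub0r oppr_le0 sqr_ge0.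
have cs := @continuous_halfchord s.
have -> : (\int[mu]_x (2 * Num.sqrt (s ^+ 2 - x ^+ 2))%:E =
    \int[mu]_(x in `[(- s)%R, s]) (2 * Num.sqrt (s ^+ 2 - x ^+ 2))%:E)%E.
  rewrite [RHS]integral_mkcond; apply: eq_integral => x _.
  rewrite patchE; case: ifPn => //; rewrite notin_setE /= in_itv /= => xs.
  rewrite ler0_sqrtr ?mulr0 // subr_le0 leNgt -[x ^+ 2](real_normK (num_real x)).
  rewrite ltr_sqr ?nnegrE //; last lra.
  by rewrite ltr_norml; apply/negP => /andP[h1 h2]; apply: xs; lra.
rewrite -[LHS]fineK; last first.
  by apply: integrable_fin_num => //; exact: continuous_integrable_itv.
congr EFin.
have m11 : - 1 <= 1 :> R by lra.
have := Rintegral_affine 0 cs s0 m11.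
rewrite !addr0 mulrN mulr1 /Rintegral => ->.
rewrite -/(Rintegral _ _ _) expr2 -mulrA; congr (_ * _).
rewrite /unit_area -RintegralZl //; last first.
  have := @continuous_halfchord 1; rewrite expr1n.
  exact: continuous_integrable_itv.
apply: eq_Rintegral => x _; rewrite addr0.
have -> : s ^+ 2 - (s * x) ^+ 2 = s ^+ 2 * (1 - x ^+ 2) by ring.
by rewrite sqrtrM ?sqr_ge0 // sqrtr_sqr gtr0_norm //; ring.
Qed.

Lemma subset_disk s t : 0 <= s -> s <= t -> @disk R s `<=` disk t.
Proof.
move=> s0 st p; rewrite /disk /= => /le_trans; apply.
by rewrite ler_sqr ?nnegrE //; lra.
Qed.

Lemma uniform_disk_prob (rho : R) (Q : set (plane R) -> \bar R) s :
  0 < rho -> uniform_over (disk rho) Q -> 0 <= s -> s <= rho ->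
  Q (disk s) = (s ^+ 2 / rho ^+ 2)%:E.
Proof.
move=> rho0 hQ s0 sr; rewrite hQ; last exact: measurable_disk.
rewrite setIidl; last exact: subset_disk.
rewrite !area_disk ?(ltW rho0) //=; congr EFin.
by field; rewrite !gt_eqF ?unit_area_gt0.
Qed.

End DiskArea.

(** * Functions with small increments *)

Section Increments.
Variable R : realType.
Notation mu := (@lebesgue_measure R).
Implicit Types (D m f : R -> R) (s t C K : R).

(** Over n equal steps the errors sum to at most C (K / n) (m K - m 0), because
    the increments of m telescope; n is arbitrary. *)
Lemma increments_eq D m C K : 0 <= C -> 0 <= K ->
  (forall s t, 0 <= s -> s <= t -> t <= K ->
    `|D t - D s| <= C * (t - s) * (m t - m s)) ->
  D K = D 0.
Proof.
move=> C0 K0 incr; apply/eqP; rewrite -subr_eq0 -normr_le0 leNgt; apply/negP.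
set delta := `|_| => delta0.
pose B := C * K * (m K - m 0).
pose n := Num.bound `|B / delta|.
have n0 : 0 < n.+1%:R :> R by rewrite ltr0n.
pose c := K / n.+1%:R.
pose x (i : nat) : R := i%:R * c.
have c0 : 0 <= c by rewrite divr_ge0 // ltW.
have xS i : x i.+1 - x i = c by rewrite /x -addn1 natrD; ring.
have xn : x n.+1 = K by rewrite /x /c mulrC divfK // gt_eqF.
have main i : (i <= n.+1)%N ->
    `|D (x i) - D 0| <= C * c * (m (x i) - m 0).
  elim: i => [_|i IH i_n]; first by rewrite /x mul0r !subrr normr0 mulr0.
  have xi0 : 0 <= x i by rewrite mulr_ge0.
  have xii : x i <= x i.+1 by rewrite -subr_ge0 xS.
  have xiK : x i.+1 <= K by rewrite -xn /x ler_wpM2r // ler_nat.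
  have := incr _ _ xi0 xii xiK; rewrite xS.
  have := IH (ltnW i_n).
  by have := ler_distD (D (x i)) (D (x i.+1)) (D 0); lra.
have := main _ (leqnn _); rewrite xn -/delta leNgt => /negP; apply.
have -> : C * c * (m K - m 0) = B / n.+1%:R by rewrite /B /c; ring.
rewrite ltr_pdivrMr // mulrC -ltr_pdivrMr //.
apply: le_lt_trans (ler_norm _) _.
by apply: lt_le_trans (archi_boundP (normr_ge0 _)) _; rewrite ler_nat.
Qed.

Lemma Rintegral_monomial k s t : s <= t ->
  \int[mu]_(x in `[s, t]) (k.+1%:R * x ^+ k) = t ^+ k.+1 - s ^+ k.+1.
Proof.
rewrite le_eqVlt => /predU1P[->|st].
  by rewrite set_itv1 Rintegral_set1 subrr.
have dX (x : R) : is_derive x (1 : R) (fun y : R => y ^+ k.+1) (k.+1%:R * x ^+ k).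
  have := @is_deriveX R R id k.+1 x 1 1 (is_derive_id _ _).
  by rewrite exprfctE [_ *: _]mulr1.
have cX : continuous (fun x : R => x ^+ k.+1) by exact: exprn_continuous.
rewrite /Rintegral (@continuous_FTC2 _ _ (fun x : R => x ^+ k.+1)) //.
- apply: continuous_subspaceT => x; apply: cvgM; first exact: cvg_cst.
  exact: exprn_continuous.
- split; first by move=> x _; case: (dX x).
    by apply: cvg_at_right_filter; exact: cX.
  by apply: cvg_at_left_filter; exact: cX.
- by move=> x _; rewrite derive1E; apply: derive_val.
Qed.

Lemma Rintegral_weighted_bounds d (X : measurableType d)
    (Q : {measure set X -> \bar R}) (A : set X) (f g : X -> R) a b :
  measurable A -> Q.-integrable A (EFin \o g) ->
  Q.-integrable A (EFin \o (fun x => g x * f x)) ->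
  (forall x, A x -> 0 <= g x) -> (forall x, A x -> a <= f x <= b) ->
  a * \int[Q]_(x in A) g x <= \int[Q]_(x in A) (g x * f x) <=
    b * \int[Q]_(x in A) g x.
Proof.
move=> mA ig igf g0 fab; rewrite -!RintegralZl //.
have iZ c : Q.-integrable A (EFin \o (fun x => c * g x)).
  have := @integrableZl _ _ _ Q A mA c _ ig.
  by apply: eq_integrable => // x _; rewrite /= EFinM.
apply/andP; split; apply: le_Rintegral => // x Ax; have /andP[fa fb] := fab _ Ax.
- by rewrite mulrC ler_wpM2l ?g0.
- by rewrite [leRHS]mulrC ler_wpM2l ?g0.
Qed.

End Increments.

(** * Expectation of a monotone function of the radius *)

Section MonotoneIncrements.
Variable R : realType.
Notation mu := (@lebesgue_measure R).
Implicit Types (F f : R -> R) (s t K : R).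

(** The weight 2 x integrates to t^2 - s^2. *)
Lemma linear_weight_bounds F s t : continuous F -> 0 <= s -> s <= t ->
  (forall x, s <= x <= t -> F s <= F x <= F t) ->
  F s * (t ^+ 2 - s ^+ 2) <= \int[mu]_(x in `[s, t]) (2 * x * F x) <=
    F t * (t ^+ 2 - s ^+ 2).
Proof.
move=> cF s0 st Fst.
have c2 : continuous (fun x : R => 2 * x) by exact: mulrl_continuous.
rewrite -(Rintegral_monomial 1 st).
apply: Rintegral_weighted_bounds => //.
- exact: continuous_integrable_itv c2.
- apply: continuous_integrable_itv => x.
  by apply: cvgM; [exact: c2|exact: cF].
- by move=> x /=; rewrite in_itv /= => /andP[sx _]; rewrite mulr_ge0 ?(le_trans s0 sx).
Qed.

(** The difference D between the contribution of T <= s to the left-hand side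
    and the right-hand side truncated at s has increments bounded as in
    [increments_eq], with m = F, and vanishes at 0. *)
Lemma integral_square_law d (X : measurableType d) (Q : {measure set X -> \bar R})
    (T : X -> R) F K :
  measurable_fun setT T -> 0 < K -> (forall x, 0 <= T x) ->
  (forall s, 0 <= s -> s <= K -> Q [set x | T x <= s] = (s ^+ 2 / K ^+ 2)%:E) ->
  continuous F -> {in `[0, K] &, {homo F : x y / x <= y}} ->
  (\int[Q]_(x in [set x | (T x <= K)%R]) (F (T x))%:E)%E =
    (K ^- 2 * \int[mu]_(w in `[0, K]) (2 * w * F w))%:E.
Proof.
move=> mT K0 T0 QT cF mF.
pose A s := [set x | T x <= s].
have QA s : 0 <= s -> s <= K -> Q (A s) = (s ^+ 2 / K ^+ 2)%:E := QT s.
have mA s : measurable (A s).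
  have -> : A s = setT `&` T @^-1` `]-oo, s].
    by apply/seteqP; split => x /=; rewrite /A /= in_itv //= => -[].
  exact: mT.
have mFT : measurable_fun setT (F \o T).
  by apply: measurableT_comp => //; exact: continuous_measurable_fun.
have Fb x : A K x -> F 0 <= F (T x) <= F K.
  rewrite /A /= => TK; have := T0 x => Tx0.
  by apply/andP; split; apply: mF; rewrite ?in_itv /=; lra.
have iFT : Q.-integrable (A K) (EFin \o (F \o T)).
  apply: measurable_bounded_integrable => //.
  - by rewrite QA ?(ltW K0) // ltry.
  - exact: measurable_funS mFT.
  - exists (`|F 0| + `|F K|); split => // M HM x /Fb /andP[h1 h2] /=.
    apply: le_trans (ltW HM); rewrite ler_norml; apply/andP; split.
      by have := ler_norm (- F 0); rewrite normrN; have := normr_ge0 (F K); lra.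
    by have := ler_norm (F K); have := normr_ge0 (F 0); lra.
rewrite -[LHS]fineK; last first.
  exact: (@integrable_fin_num _ X R Q (A K) (mA K) (fun x => (F (T x))%:E) iFT).
congr EFin; rewrite -/(Rintegral Q (A K) (F \o T)).
have cwF : continuous (fun w : R => 2 * w * F w).
  by move=> w; apply: cvgM; [exact: mulrl_continuous|exact: cF].
pose D s := \int[Q]_(x in A s) F (T x) - K ^- 2 * \int[mu]_(w in `[0, s]) (2 * w * F w).
suff DK : D K = D 0.
  apply/eqP; rewrite -subr_eq0 -/(D K) DK /D set_itv1 Rintegral_set1 mulr0 subr0.
  rewrite /Rintegral null_set_integral //.
    apply/measurable_EFinP; exact: measurable_funS mFT.
  by rewrite QA ?lexx ?(ltW K0) // expr0n mul0r.
have KV : 0 < K ^- 2 by rewrite invr_gt0 exprn_gt0.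
apply: (@increments_eq _ D F (2 * K * K ^- 2)) => [||s t s0 st tK].
- by rewrite !mulr_ge0 ?ltW.
- exact: ltW.
have t0 := le_trans s0 st.
have sK := le_trans st tK.
have Fst x : s <= x <= t -> F s <= F x <= F t.
  by move=> /andP[sx xt]; apply/andP; split; apply: mF; rewrite ?in_itv /=; lra.
have As : A s `<=` A t by move=> x /= /le_trans; apply.
have AK : A t `<=` A K by move=> x /= /le_trans; apply.
have mB : measurable (A t `\` A s) by exact: measurableD.
have QB : Q (A t `\` A s) = ((t ^+ 2 - s ^+ 2) / K ^+ 2)%:E.
  have Qt : (Q (A t) < +oo)%E by rewrite QA // ltry.
  transitivity (Q (A t) - Q (A s))%E; last by rewrite !QA // -EFinB mulrBl.
  by rewrite measureD ?setIidr.
have QD : \int[Q]_(x in A t) F (T x) =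
    \int[Q]_(x in A s) F (T x) + \int[Q]_(x in A t `\` A s) F (T x).
  have At : A t = A s `|` (A t `\` A s) by rewrite setDUK.
  rewrite {1}At Rintegral_setU //.
    by rewrite -At; exact: integrableS iFT.
  by apply/disj_set2P; rewrite setIDA setIidl // setDv.
(* Contribution of the event s < T <= t. *)
have := @Rintegral_weighted_bounds R d X Q (A t `\` A s) (F \o T) (cst 1) (F s) (F t) mB.
case/(_ _ _ _ _)/andP.
- apply: measurable_bounded_integrable => //; first by rewrite QB ltry.
  by exists 1; split => // M M1 x _ /=; rewrite normr1 ltW.
- under eq_fun do rewrite mul1r.
  by apply: integrableS iFT => //; apply: subset_trans AK; exact: subDsetl.
- by move=> *; exact: ler01.
- move=> x [/= xt /negP]; rewrite -ltNge => /ltW sx; apply: Fst; rewrite sx; exact: xt.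
under [X in _ <= X -> _]eq_Rintegral do rewrite mul1r.
under [X in _ -> X <= _ -> _]eq_Rintegral do rewrite mul1r.
rewrite Rintegral_cst // mul1r QB /= => q1 q2.
have /andP[w1 w2] := linear_weight_bounds cF s0 st Fst.
have WD : \int[mu]_(w in `[0, t]) (2 * w * F w) =
    \int[mu]_(w in `[0, s]) (2 * w * F w) + \int[mu]_(w in `[s, t]) (2 * w * F w).
  by apply: Rintegral_itv_split => //; exact: continuous_integrable_itv.
rewrite /D QD WD.
move: (\int[Q]_(x in A s) _) (\int[Q]_(x in _ `\` _) _) q1 q2 => I1 I2 q1 q2.
move: (\int[mu]_(x in `[0, s]) _) (\int[mu]_(x in `[s, t]) _) w1 w2 => J1 J2 w1 w2.
have /andP[Fle _] : F s <= F t <= F t by apply: Fst; rewrite st lexx.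
have w1' := ler_wpM2l (ltW KV) w1; have w2' := ler_wpM2l (ltW KV) w2.
have st2 : (t ^+ 2 - s ^+ 2) * (F t - F s) <= 2 * K * (t - s) * (F t - F s).
  by apply: ler_wpM2r; [lra|nra].
have st2' := ler_wpM2l (ltW KV) st2.
rewrite ler_norml; apply/andP; split; lra.
Qed.

End MonotoneIncrements.

(** * The integral of the inverse function *)

Section InverseFunction.
Variable R : realType.
Notation mu := (@lebesgue_measure R).
Implicit Types (f wt : R -> R) (s t K : R).

(** With K replaced by s, the increments over [s, t] of both sides lie between
    s^2 and t^2 times f(t)^(n+1) - f(s)^(n+1): on the left because
    s <= wt <= t on [f s, f t], on the right by [linear_weight_bounds]. *)
Lemma Rintegral_inverse f wt K n : 0 < K -> continuous f -> 0 <= f 0 ->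
  {in `[0, K] &, {homo f : x y / x < y}} ->
  (forall x, f 0 <= x <= f K -> 0 <= wt x <= K /\ f (wt x) = x) ->
  n.+1%:R * \int[mu]_(x in `[f 0, f K]) (x ^+ n * wt x ^+ 2) =
  K ^+ 2 * f K ^+ n.+1 - \int[mu]_(w in `[0, K]) (2 * w * f w ^+ n.+1).
Proof.
move=> K0 cf f0 f_lt fwt.
have f_mono : {in `[0, K] &, {mono f : x y / x <= y}} by exact: le_mono_in.
have in0K s : 0 <= s -> s <= K -> s \in `[0, K] by move=> s0 sK; rewrite in_itv /= s0.
have f_le s t : 0 <= s -> s <= t -> t <= K -> f s <= f t.
  by move=> s0 st tK; rewrite f_mono // in0K //; [exact: le_trans tK|exact: le_trans st].
have wtf s t x : 0 <= s -> s <= t -> t <= K -> f s <= x <= f t -> s <= wt x <= t.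
  move=> s0 st tK /andP[sx xt].
  have [/andP[w0 wK] fw] : 0 <= wt x <= K /\ f (wt x) = x.
    apply: fwt; rewrite (le_trans (f_le 0 s _ _ _) sx) ?(le_trans xt (f_le t K _ _ _)) //.
    - exact: le_trans st.
    - exact: le_trans tK.
  have sin : s \in `[0, K] by rewrite in0K // (le_trans st).
  have tin : t \in `[0, K] by rewrite in0K // (le_trans s0).
  have win : wt x \in `[0, K] by rewrite in0K.
  by apply/andP; split; rewrite -f_mono // fw.
(* As a left inverse of f, wt is continuous, hence integrable. *)
have wtK : {in `[0, K], cancel f wt}.
  move=> s; rewrite in_itv /= => /andP[s0 sK].
  by apply/le_anti; rewrite andbC; apply: wtf; rewrite ?lexx.
have cwt : {within `[f 0, f K], continuous wt}.
  apply: segment_can_le_continuous wtK; first exact: ltW.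
  exact: continuous_subspaceT.
have cX : continuous (fun x : R => n.+1%:R * x ^+ n).
  by move=> x; apply: cvgM; [exact: cvg_cst|exact: exprn_continuous].
have iXwt : mu.-integrable `[f 0, f K] (EFin \o (fun x => x ^+ n * wt x ^+ 2)).
  apply: continuous_compact_integrable; first exact: segment_compact.
  move=> x; apply: cvgM.
    by apply: (@continuous_subspaceT _ _ _ (fun x : R => x ^+ n)) => y;
      exact: exprn_continuous.
  by apply: cvgM; exact: cwt.
have iwt : mu.-integrable `[f 0, f K] (EFin \o (fun x => n.+1%:R * x ^+ n * wt x ^+ 2)).
  have := @integrableZl _ _ _ mu _ (measurable_itv _) n.+1%:R _ iXwt.
  by apply: eq_integrable => // x _; rewrite /= -EFinM mulrA.
rewrite -RintegralZl //.
under [X in X = _]eq_Rintegral do rewrite mulrA.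
have cfX : continuous (fun w => f w ^+ n.+1).
  move=> w; apply: (@continuous_comp _ _ _ f (fun x => x ^+ n.+1)); first exact: cf.
  exact: exprn_continuous.
have cwf : continuous (fun w : R => 2 * w * f w ^+ n.+1).
  by move=> w; apply: cvgM; [exact: mulrl_continuous|exact: cfX].
pose D s := \int[mu]_(x in `[f 0, f s]) (n.+1%:R * x ^+ n * wt x ^+ 2) -
  (s ^+ 2 * f s ^+ n.+1 - \int[mu]_(w in `[0, s]) (2 * w * f w ^+ n.+1)).
suff DK : D K = D 0.
  apply/eqP; rewrite -subr_eq0 -/(D K) DK /D !set_itv1 !Rintegral_set1.
  by rewrite expr0n mul0r !subr0.
apply: (@increments_eq _ D (fun s => f s ^+ n.+1) (2 * K)) => [||s t s0 st tK].
- by rewrite mulr_ge0 ?ltW.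
- exact: ltW.
have t0 := le_trans s0 st; have sK := le_trans st tK.
have fs0 x : 0 <= x -> x <= K -> 0 <= f x by move=> x0 xK; apply: le_trans f0 _; exact: f_le.
have fX_le x y : 0 <= x -> x <= y -> y <= K -> f x ^+ n.+1 <= f y ^+ n.+1.
  move=> x0 xy yK; rewrite lerXn2r ?nnegrE ?fs0 ?f_le //.
  - exact: le_trans yK.
  - exact: le_trans xy.
have iD : \int[mu]_(x in `[f 0, f t]) (n.+1%:R * x ^+ n * wt x ^+ 2) =
    \int[mu]_(x in `[f 0, f s]) (n.+1%:R * x ^+ n * wt x ^+ 2) +
    \int[mu]_(x in `[f s, f t]) (n.+1%:R * x ^+ n * wt x ^+ 2).
  apply: Rintegral_itv_split; [exact: f_le|exact: f_le|].
  by apply: integrableS iwt => //; apply: subset_itvl; rewrite bnd_simp f_le.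
have WD : \int[mu]_(w in `[0, t]) (2 * w * f w ^+ n.+1) =
    \int[mu]_(w in `[0, s]) (2 * w * f w ^+ n.+1) +
    \int[mu]_(w in `[s, t]) (2 * w * f w ^+ n.+1).
  by apply: Rintegral_itv_split => //; exact: continuous_integrable_itv.
have /andP[w1 w2] : f s ^+ n.+1 * (t ^+ 2 - s ^+ 2) <=
    \int[mu]_(x in `[s, t]) (2 * x * f x ^+ n.+1) <= f t ^+ n.+1 * (t ^+ 2 - s ^+ 2).
  apply: (@linear_weight_bounds R (fun x => f x ^+ n.+1)) => // x /andP[sx xt].
  by rewrite !fX_le //; [exact: le_trans sx|exact: le_trans tK].
have /andP[v1 v2] : s ^+ 2 * (f t ^+ n.+1 - f s ^+ n.+1) <=
    \int[mu]_(x in `[f s, f t]) (n.+1%:R * x ^+ n * wt x ^+ 2) <=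
    t ^+ 2 * (f t ^+ n.+1 - f s ^+ n.+1).
  rewrite -(Rintegral_monomial n (f_le _ _ s0 st tK)).
  apply: Rintegral_weighted_bounds => //.
  - exact: continuous_integrable_itv cX.
  - by apply: integrableS iwt => //; apply: subset_itv; rewrite bnd_simp f_le.
  - move=> x /=; rewrite in_itv /= => /andP[fx _].
    by rewrite mulr_ge0 ?exprn_ge0 // (le_trans (fs0 _ s0 sK)).
  - move=> x /=; rewrite in_itv /= => /(wtf _ _ _ s0 st tK) /andP[sw wt'].
    have w0 := le_trans s0 sw.
    by rewrite !lerXn2r ?nnegrE.
rewrite /D iD WD; have := fX_le s t s0 st tK.
move: (f s ^+ _) (f t ^+ _) w1 w2 v1 v2 => a b w1 w2 v1 v2 ab.
move: (\int[mu]_(x in `[f 0, f s]) _) (\int[mu]_(x in `[f s, f t]) _) v1 v2 => I1 I2 v1 v2.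
move: (\int[mu]_(x in `[0, s]) _) (\int[mu]_(x in `[s, t]) _) w1 w2 => J1 J2 w1 w2.
have st2 : (t ^+ 2 - s ^+ 2) * (b - a) <= 2 * K * (t - s) * (b - a).
  by apply: ler_wpM2r; [lra|nra].
by rewrite ler_norml; apply/andP; split; lra.
Qed.

End InverseFunction.

(** * The moments *)

Theorem mainTheorem5 (R : realType) (r rho kappa : R)
  (hr : 0 < r) (hrho : 0 < rho) (hkappa : kappa = rho / r)
  (d : measure_display) (Omega : measurableType d) (Pr : probability Omega R)
  (P : {RV Pr >-> plane R})
  (hP : uniform_over (disk rho) (distribution Pr P)) :
  (forall k : nat, (1 <= k)%N ->
     'E_Pr[(fun omega => perimeter r (P omega) ^+ k)%R]%E =
       (2 ^+ (2 * k + 1) * r ^+ k / kappa ^+ 2 *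
        \int[lebesgue_measure]_(w in `[0, kappa])
          (w * (w + 1) ^+ k
           * ellipticE (2 * Num.sqrt w / (w + 1)) ^+ k))%:E)
  /\ (forall x : R, 2 * pi <= x <= h kappa ->
        exists! w : R, 0 <= w /\ h w = x)
  /\ (forall wt : R -> R,
        (forall x : R, 2 * pi <= x <= h kappa ->
           0 <= wt x /\ h (wt x) = x) ->
        forall k : nat, (1 <= k)%N ->
          'E_Pr[(fun omega => perimeter r (P omega) ^+ k)%R]%E =
            (r ^+ k * (h kappa ^+ k - k%:R / kappa ^+ 2 *
             \int[lebesgue_measure]_(x in `[2 * pi, h kappa])
               (x ^+ k.-1 * wt x ^+ 2)))%:E).
Proof.
have kappa0 : 0 < kappa by rewrite hkappa divr_gt0.
pose f (w : R) : R := 4 * quarter_length 1 w.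
have hf w : 0 <= w -> h w = f w := @hE R w.
have cf : continuous f.
  by move=> w; apply: cvgM; [exact: cvg_cst|exact: continuous_quarter_length].
have f_lt x y : 0 <= x -> x < y -> f x < f y.
  by move=> x0 xy; rewrite ltr_pM2l //; exact: quarter_length_lt.
have f0 : f 0 = 2 * pi.
  have pi2 : 0 < pi / 2 :> R by rewrite divr_gt0 ?pi_gt0.
  rewrite /f /quarter_length.
  under eq_Rintegral do rewrite /speed /sq_speed addr0 mulr0 mul0r subr0 expr1n sqrtr1.
  rewrite Rintegral_cst //= lebesgue_measure_itv /= lte_fin pi2 /= subr0.
  by field.
have f_ltK : {in `[0, kappa] &, {homo f : x y / x < y}}.
  by move=> x y; rewrite in_itv /= => /andP[x0 _] _; exact: f_lt.
have f_leK : {in `[0, kappa] &, {homo f : x y / x <= y}} by exact: ltW_homo_in.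
have f_ge0 w : 0 <= f w.
  by rewrite mulr_ge0 // Rintegral_ge0 // => t _; exact: sqrtr_ge0.
have cfk k : continuous (fun w => f w ^+ k).
  move=> w; apply: (@continuous_comp _ _ _ f (fun x => x ^+ k)); first exact: cf.
  exact: exprn_continuous.
have cwf k : continuous (fun w : R => 2 * w * f w ^+ k).
  by move=> w; apply: cvgM; [exact: mulrl_continuous|exact: cfk].
(* The k-th moment of U, with h written as the continuous function f. *)
have mom k : 'E_Pr[(fun omega => perimeter r (P omega) ^+ k)%R]%E =
    (r ^+ k / kappa ^+ 2 *
     \int[lebesgue_measure]_(w in `[0, kappa]) (2 * w * f w ^+ k))%:E.
  pose T omega := Num.sqrt ((P omega).1 ^+ 2 + (P omega).2 ^+ 2) / r.
  pose F w := r ^+ k * f w ^+ k.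
  have T0 omega : 0 <= T omega by rewrite divr_ge0 ?sqrtr_ge0 ?ltW.
  have perT omega : perimeter r (P omega) ^+ k = F (T omega).
    rewrite perimeterE ?(ltW hr) // /F -exprMn; congr (_ ^+ k).
    have rT : r * T omega = Num.sqrt ((P omega).1 ^+ 2 + (P omega).2 ^+ 2).
      by rewrite /T mulrC divfK // gt_eqF.
    by rewrite -rT -{1}[r]mulr1 (quarter_lengthZ _ _ (ltW hr)) /f mulrCA.
  have mT : measurable_fun setT T.
    have mP := measurableT_comp (@measurable_sqnorm R) (measurable_funPT P).
    have msP := measurableT_comp (continuous_measurable_fun (@sqrt_continuous R)) mP.
    by apply: measurable_funM; [exact: msP|exact: measurable_cst].
  have cF : continuous F.
    by move=> w; apply: cvgM; [exact: cvg_cst|exact: cfk].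
  have F0 w : 0 <= F w by rewrite mulr_ge0 ?exprn_ge0 // ltW.
  have mF : {in `[0, kappa] &, {homo F : x y / x <= y}}.
    move=> x y xK yK xy; apply: ler_wpM2l; first by rewrite exprn_ge0 // ltW.
    by apply: lerXn2r; rewrite ?nnegrE ?f_ge0 //; exact: f_leK.
  have law s : 0 <= s -> s <= kappa ->
      Pr [set omega | T omega <= s] = (s ^+ 2 / kappa ^+ 2)%:E.
    move=> s0 sK.
    have rs0 : 0 <= r * s by rewrite mulr_ge0 // ltW.
    have rsrho : r * s <= rho by move: sK; rewrite hkappa ler_pdivlMr // mulrC.
    have -> : [set omega | T omega <= s] = P @^-1` disk (r * s).
      apply/seteqP; split=> omega; rewrite /T /disk /= ler_pdivrMr // [s * r]mulrC.
        rewrite -ler_sqr ?nnegrE ?sqrtr_ge0 // sqr_sqrtr //.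
        by rewrite addr_ge0 ?sqr_ge0.
      move=> le; rewrite -ler_sqr ?nnegrE ?sqrtr_ge0 // sqr_sqrtr //.
      by rewrite addr_ge0 ?sqr_ge0.
    have := uniform_disk_prob hrho hP rs0 rsrho.
    rewrite /distribution /pushforward => ->; congr EFin.
    by rewrite hkappa; field; rewrite !gt_eqF.
  rewrite unlock; under eq_integral do rewrite perT.
  have := integral_square_law mT kappa0 T0 law cF mF.
  set A := [set omega | _].
  have mA : measurable A.
    have -> : A = setT `&` T @^-1` `]-oo, kappa].
      by apply/seteqP; split => x /=; rewrite /A /= in_itv //= => -[].
    exact: mT.
  have PrA : Pr (~` A) = 0%E.
    rewrite probability_setC // law ?lexx ?(ltW kappa0) // divff ?subee //.
    by rewrite expf_eq0 gt_eqF.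
  have mFT : measurable_fun setT (EFin \o (F \o T)).
    apply/measurable_EFinP; apply: measurableT_comp => //.
    exact: continuous_measurable_fun.
  have F0' omega : [set: Omega] omega -> (0 <= (EFin \o (F \o T)) omega)%E.
    by move=> _; rewrite lee_fin; exact: F0.
  have := ge0_negligible_integral (measurableC mA) measurableT mFT F0' PrA.
  rewrite setTD setCK /= => -> ->; congr EFin.
  have -> : \int[lebesgue_measure]_(w in `[0, kappa]) (2 * w * F w) =
      r ^+ k * \int[lebesgue_measure]_(w in `[0, kappa]) (2 * w * f w ^+ k).
    rewrite -RintegralZl //; last exact: continuous_integrable_itv.
    by apply: eq_Rintegral => w _; rewrite /F mulrCA.
  by rewrite mulrCA mulrA.
split; [|split].
- move=> k _; rewrite mom; congr EFin.
  have -> : \int[lebesgue_measure]_(w in `[0, kappa])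
      (w * (w + 1) ^+ k * ellipticE (2 * Num.sqrt w / (w + 1)) ^+ k) =
      (2 * 4 ^+ k)^-1 *
      \int[lebesgue_measure]_(w in `[0, kappa]) (2 * w * f w ^+ k).
    rewrite -RintegralZl //; last exact: continuous_integrable_itv.
    apply: eq_Rintegral => w; rewrite inE /= in_itv /= => /andP[w0 _].
    rewrite -hf // /h !exprMn; field.
    by rewrite expf_neq0 // pnatr_eq0.
  have -> : 2 ^+ (2 * k + 1) = 2 * 4 ^+ k :> R.
    rewrite addn1 exprS exprM; congr (_ * _ ^+ k); ring.
  field; rewrite expf_neq0 ?pnatr_eq0 //= gt_eqF //.
- move=> x; rewrite -f0 hf ?(ltW kappa0) // => /andP[x0 xK].
  have [|w] := @IVT R f 0 kappa x (ltW kappa0) (continuous_subspaceT cf).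
    by rewrite min_l ?max_r ?x0 // (le_trans x0 xK).
  rewrite in_itv /= => /andP[w0 _] fw; exists w; split; first by rewrite hf.
  move=> v [v0]; rewrite hf // -fw => fvw.
  by case: (ltgtP w v) => // /f_lt; rewrite ?w0 ?v0 fvw ltxx => /(_ isT).
- move=> wt hwt [//|n] _; rewrite mom; congr EFin.
  rewrite -f0 hf ?(ltW kappa0) //.
  have wtP x : f 0 <= x <= f kappa -> 0 <= wt x <= kappa /\ f (wt x) = x.
    move=> xb; have [|w0] := hwt x; first by rewrite -f0 hf ?(ltW kappa0).
    rewrite hf // => fw; rewrite w0 fw; split => //=.
    rewrite leNgt; apply/negP => /(f_lt _ _ (ltW kappa0)).
    by rewrite fw ltNge; case/andP: xb => _ ->.
  have := Rintegral_inverse n kappa0 cf (f_ge0 0) f_ltK wtP.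
  set J := Rintegral _ _ _ => invJ.
  set I := Rintegral _ _ _ in invJ *.
  have -> : I = kappa ^+ 2 * f kappa ^+ n.+1 - n.+1%:R * J by rewrite invJ; ring.
  by field; rewrite gt_eqF.
Qed.
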